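(* Let $A$ be a Banach algebra and let $a\in A$. Then the following are equivalent: (1) $a$ has generalized Hirano inverse. (2) There exists $e\in comm(a)$ with $e^3=e$ such that $a-e\in A^{qnil}$.
   Context: All Banach algebras are complex with identity $1$. For $a\in A$, $comm(a)=\{x\in A : xa=ax\}$, and $A^{qnil}=\{a\in A : 1+ax \text{ is invertible in } A \text{ for all } x\in comm(a)\}$ is the set of quasinilpotent elements. An element $a\in A$ has generalized Hirano inverse if there exists $b\in comm(a)$ with $b=bab$ and $a^2-ab\in A^{qnil}$. *)

(* Defs.v *)
From HB Require Import structures.
From mathcomp Require Import all_boot all_order all_algebra.
From mathcomp Require Import complex.
From mathcomp Require Import all_classical all_reals all_analysis.

Set Implicit Arguments.
Unset Strict Implicit.
Unset Printing Implicit Defensive.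

Import Order.TTheory GRing.Theory Num.Theory.
Import numFieldNormedType.Exports.

Local Open Scope classical_set_scope.
Local Open Scope ring_scope.

(* NumDomain already inherits from both NormedZmodule and NzRing, so HB rejects a
   structure joining CompleteNormedModule with Algebra. The product is therefore part
   of the mixin, and the algebra instances are derived from it afterwards.
   The normalization `|1| = 1 is not imposed; submultiplicativity suffices. *)
HB.mixin Record CompleteNormedModule_isBanachAlgebra (K : numFieldType) A
    of CompleteNormedModule K A := {
  bone : A;
  bmul : A -> A -> A;
  bmulA : associative bmul;
  bmul1l : left_id bone bmul;
  bmul1r : right_id bone bmul;
  bmulDl : left_distributive bmul +%R;
  bmulDr : right_distributive bmul +%R;
  bone_neq0 : bone != 0;
  bscaleAl : forall (k : K) (x y : A), k *: bmul x y = bmul (k *: x) y;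
  bscaleAr : forall (k : K) (x y : A), k *: bmul x y = bmul x (k *: y);
  bnormM_le : forall x y : A, `|bmul x y| <= `|x| * `|y|
}.

#[short(type="banachAlgType")]
HB.structure Definition BanachAlgebra (K : numFieldType) :=
  {A of CompleteNormedModule_isBanachAlgebra K A & CompleteNormedModule K A}.

Section BanachAlgebraInstances.
Variables (K : numFieldType) (A : banachAlgType K).

#[non_forgetful_inheritance]
HB.instance Definition _ := GRing.Zmodule_isNzRing.Build A
  (@bmulA K A) (@bmul1l K A) (@bmul1r K A) (@bmulDl K A) (@bmulDr K A)
  (@bone_neq0 K A).

#[non_forgetful_inheritance]
HB.instance Definition _ :=
  GRing.LSemiModule_isLSemiAlgebra.Build K A (@bscaleAl K A).

#[non_forgetful_inheritance]
HB.instance Definition _ :=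
  GRing.LSemiAlgebra_isSemiAlgebra.Build K A (@bscaleAr K A).

Definition binvertible (x : A) : bool :=
  `[< exists y : A, y * x = 1 /\ x * y = 1 >].

Definition binv (x : A) : A :=
  if binvertible x then xget x [set y | y * x = 1 /\ x * y = 1] else x.

Let binvP (x : A) : binvertible x -> binv x * x = 1 /\ x * binv x = 1.
Proof.
move=> ux; rewrite /binv ux; case: xgetP => [y _ //|].
by move/asboolP: ux => [y yP] /(_ y).
Qed.

Let binvl : {in binvertible, left_inverse 1 binv *%R}.
Proof. by move=> x /binvP[]. Qed.

Let binvr : {in binvertible, right_inverse 1 binv *%R}.
Proof. by move=> x /binvP[]. Qed.

Let binvertibleP (x y : A) : y * x = 1 /\ x * y = 1 -> binvertible x.
Proof. by move=> xyP; apply/asboolP; exists y. Qed.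

Let binv_out : {in [predC binvertible], binv =1 id}.
Proof. by move=> x /negPf ux; rewrite /binv -[binvertible x]/(x \in binvertible) ux. Qed.

#[non_forgetful_inheritance]
HB.instance Definition _ := GRing.NzRing_hasMulInverse.Build A
  binvl binvr binvertibleP binv_out.

Lemma normrM_le (x y : A) : `|x * y| <= `|x| * `|y|.
Proof. exact: bnormM_le. Qed.

End BanachAlgebraInstances.

Definition commutant (A : pzRingType) (a : A) : set A :=
  [set x | GRing.comm x a].

Definition qnil {A : unitRingType} : set A :=
  [set a | forall x, commutant a x -> 1 + a * x \is a GRing.unit].

Definition has_gHirano_inverse (A : unitRingType) (a : A) : Prop :=
  exists b : A, [/\ commutant a b, b = b * a * b & qnil (a ^+ 2 - a * b)].

(* Main.v *)
(* Every [w] whose resolvent exists on the whole complex plane satisfies the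
   spectral radius formula at [0], so quasinilpotency is a condition on the norms
   of the powers of [w]; hence it is inherited by products with commuting elements
   and by square roots.
   (2) => (1): for [q = a - e], [b = e (1 + q e)^-1] gives [a b = e^2] and
   [a^2 - a b = q (2 e + q)].
   (1) => (2): for [p = a b] and [w = a^2 - p], the quasinilpotent [w] yields [v]
   with [(1 + w v)^2 = 1 + w]. Then [e = a p (1 + w v)^-1] satisfies [e^2 = p] and
   [a e = p (1 + w v)], whence [(a - e)^2 = w (1 - 2 p v)]. *)
Require Import Defs.
From HB Require Import structures.
From mathcomp Require Import all_boot all_order all_algebra.
From mathcomp Require Import complex.
From mathcomp Require Import all_classical all_reals all_analysis.
From mathcomp Require Import ring lra.

Import Order.TTheory GRing.Theory Num.Theory.
Import numFieldNormedType.Exports.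
Import Normc.

Local Open Scope classical_set_scope.
Local Open Scope ring_scope.
Local Open Scope complex_scope.

Set Implicit Arguments.
Unset Strict Implicit.
Unset Printing Implicit Defensive.

(** * Real-valued norm and geometric convergence *)

Lemma exp2V_lt (R : realType) (C e : R) : 0 < e -> exists n, C / 2 ^+ n < e.
Proof.
move=> e0; have ec0 : 0 < e / (`|C| + 1).
  by rewrite divr_gt0 // ltr_wpDl.
have [n _ /(_ n (leqnn n)) /= H] := near_infty_natSinv_expn_lt (PosNum ec0).
exists n; rewrite div1r /= in H.
have C0 := normr_ge0 C; have C1 := ler_norm C.
have V0 : 0 < (2 ^+ n : R)^-1 by rewrite invr_gt0 exprn_gt0.
have : (2 ^+ n : R)^-1 * (`|C| + 1) < e by rewrite -ltr_pdivlMr // ltr_wpDl.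
nra.
Qed.

Section RealNorm.
Variables (R : realType) (A : banachAlgType R[i]).
Implicit Types x y : A.

(** The norm takes values in [R[i]]; being nonnegative it equals its real part, on which real
    arithmetic is available. *)
Definition nrm (x : A) : R := complex.Re `|x|.

Lemma nrmE x : `|x| = (nrm x)%:C.
Proof.
by rewrite /nrm; have := normr_ge0 x; case: `|x| => p q /=;
   rewrite lecE /= => /andP[/eqP-> _].
Qed.

Lemma nrm_ge0 x : 0 <= nrm x.
Proof. by have := normr_ge0 x; rewrite nrmE lecR. Qed.

Lemma nrm_eq0 x : nrm x <= 0 -> x = 0.
Proof.
move=> x0; have nx : nrm x = 0 by apply/le_anti; rewrite x0 nrm_ge0.
by apply/eqP; rewrite -normr_eq0 nrmE nx.
Qed.

Lemma nrm0 : nrm 0 = 0.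
Proof. by rewrite /nrm normr0. Qed.

Lemma nrmD x y : nrm (x + y) <= nrm x + nrm y.
Proof. by have := ler_normD x y; rewrite !nrmE -rmorphD lecR. Qed.

Lemma nrmN x : nrm (- x) = nrm x.
Proof. by rewrite /nrm normrN. Qed.

Lemma nrmB x y : nrm (x - y) <= nrm x + nrm y.
Proof. by rewrite -(nrmN y) nrmD. Qed.

Lemma nrmM x y : nrm (x * y) <= nrm x * nrm y.
Proof. by have := normrM_le x y; rewrite !nrmE -rmorphM lecR. Qed.

Lemma nrmZ (k : R[i]) x : nrm (k *: x) = normc k * nrm x.
Proof. by apply: (@complexI R); rewrite rmorphM /= -!nrmE normrZ. Qed.

(** The exponent [0] is excluded because [nrm 1] may exceed [1]. *)
Lemma nrmX x n : (0 < n)%N -> nrm (x ^+ n) <= nrm x ^+ n.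
Proof.
case: n => [//|n _].
elim: n => [|n IH]; first by rewrite !expr1 lexx.
rewrite exprS; apply: (le_trans (nrmM _ _)).
by rewrite [leRHS]exprS ler_wpM2l // nrm_ge0.
Qed.

(** Telescoping makes the sequence Cauchy, and completeness gives the limit. The explicit rate lets
    later identities pass to the limit by estimates alone. *)
Lemma geometric_cvg (u : nat -> A) (C : R) :
  (forall n, nrm (u n.+1 - u n) <= C / 2 ^+ n) ->
  exists l, forall n, nrm (l - u n) <= 2 * C / 2 ^+ n.
Proof.
move=> uC.
have C0 : 0 <= C by have := uC 0%N; rewrite expr0 divr1; apply: le_trans; apply: nrm_ge0.
have tail n k : nrm (u (n + k)%N - u n) <= 2 * C / 2 ^+ n - 2 * C / 2 ^+ (n + k).
  elim: k => [|k IH]; first by rewrite addn0 !subrr nrm0.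
  rewrite addnS -(subrKA (u (n + k)%N)) addrC.
  apply: (le_trans (nrmD _ _)).
  have := lerD IH (uC (n + k)%N); move/le_trans; apply.
  rewrite exprS invfM le_eqVlt; apply/orP; left; apply/eqP.
  by field; rewrite ?expf_eq0 ?pnatr_eq0 ?andbF.
have tail' n m : (n <= m)%N -> nrm (u m - u n) <= 2 * C / 2 ^+ n.
  move=> /subnKC <-; apply: (le_trans (tail _ _)).
  by rewrite lerBlDr lerDl divr_ge0 ?mulr_ge0 ?exprn_ge0.
have cvgu : cvg (u @ \oo).
  apply/cauchy_cvgP; apply: cauchy_exP => eps.
  rewrite ltcE /= => /andP[/eqP ei er].
  have [n nlt] := exp2V_lt (2 * C) er.
  exists (u n); exists n => // m /= nm.
  rewrite -ball_normE /= distrC nrmE ltcE /= ei eqxx /=.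
  exact: le_lt_trans (tail' _ _ nm) nlt.
exists (limn u) => n; apply/ler_addgt0Pr => e e0.
have eC0 : (0 : R[i]) < e%:C by rewrite ltcR.
have /cvgr_dist_lt /(_ _ eC0) [N _ HN] : u @ \oo --> limn u by [].
have := HN (maxn N n) (leq_maxl _ _); rewrite /= nrmE ltcR => d1.
have := tail' _ _ (leq_maxr N n) => d2.
rewrite -(subrKA (u (maxn N n))); apply: (le_trans (nrmD _ _)).
rewrite addrC lerD //.
exact: ltW.
Qed.
End RealNorm.

(** * Inverses and the modulus on [R[i]] *)

Lemma invrB_unit (U : unitRingType) (x y : U) :
  x \is a GRing.unit -> y \is a GRing.unit ->
  x^-1 - y^-1 = x^-1 * (y - x) * y^-1.
Proof. by move=> ux uy; rewrite mulrBr mulrBl mulVr // mul1r mulrK. Qed.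

Lemma normcX (R : rcfType) (z : R[i]) n : normc (z ^+ n) = normc z ^+ n.
Proof.
by elim: n => [|n IH]; rewrite ?expr0 ?normc1 // !exprS normcM IH.
Qed.

Lemma normc_ReIm_le (R : rcfType) (z : R[i]) :
  normc z <= `|complex.Re z| + `|complex.Im z|.
Proof.
case: z => x y /=; rewrite -(@ler_pXn2r _ 2) ?nnegrE ?addr_ge0 ?sqrtr_ge0 //.
rewrite sqr_sqrtr ?addr_ge0 ?sqr_ge0 // sqrrD !real_normK ?num_real //.
by rewrite lerD2r lerDl mulrn_wge0 // mulr_ge0.
Qed.

Lemma Re_le_normc (R : rcfType) (z : R[i]) : `|complex.Re z| <= normc z.
Proof.
case: z => x y /=; rewrite -(@ler_pXn2r _ 2) ?nnegrE ?sqrtr_ge0 //.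
by rewrite sqr_sqrtr ?addr_ge0 ?sqr_ge0 // real_normK ?num_real // lerDl sqr_ge0.
Qed.

Lemma Im_le_normc (R : rcfType) (z : R[i]) : `|complex.Im z| <= normc z.
Proof.
case: z => x y /=; rewrite -(@ler_pXn2r _ 2) ?nnegrE ?sqrtr_ge0 //.
by rewrite sqr_sqrtr ?addr_ge0 ?sqr_ge0 // real_normK ?num_real // lerDr sqr_ge0.
Qed.

Lemma normc_ge0 (R : rcfType) (z : R[i]) : 0 <= normc z.
Proof. exact: le_trans (normr_ge0 _) (Re_le_normc z). Qed.

Lemma normc_real (R : rcfType) (x : R) : normc x%:C = `|x|.
Proof. by rewrite /= expr0n addr0 sqrtr_sqr. Qed.

Lemma normc_half (R : rcfType) : normc (2^-1 : R[i]) = 2^-1.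
Proof.
rewrite normcV; congr (_^-1).
by have := @normc_real R 2; rewrite rmorph_nat => ->; rewrite normr_nat.
Qed.

(** Multiplying the spectral parameter by such a root flips the sign of an [n]-th power without
    leaving a disc around [0]. *)
Lemma unit_root_of_N1 (R : rcfType) n : (0 < n)%N ->
  exists z : R[i], z ^+ n = -1 /\ normc z = 1.
Proof.
move=> n0; exists (n.-root (-1)); have z1 := rootCK n0 (-1 : R[i]).
split=> //; apply/eqP; rewrite -(pexpr_eq1 n0) ?normc_ge0 // -normcX z1.
by rewrite normcN normc1.
Qed.

(** * Resolvents and the spectral radius formula at [0] *)

Section Spectral.
Variables (R : realType) (A : banachAlgType R[i]).
Implicit Types w x y : A.

Lemma nrmX_le x n (r : R) : nrm x <= r -> nrm (x ^+ n) <= nrm (1 : A) * r ^+ n.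
Proof.
move=> xr; elim: n => [|n IH]; first by rewrite !expr0 mulr1 lexx.
rewrite exprSr; apply: (le_trans (nrmM _ _)).
by rewrite [_ ^+ n.+1]exprSr mulrA ler_pM ?nrm_ge0.
Qed.

Lemma nrm_small_eq0 x (C : R) : (forall n, nrm x <= C / 2 ^+ n) -> x = 0.
Proof.
move=> xC; apply: nrm_eq0; apply/ler_addgt0Pr => e e0; rewrite add0r.
have [n nlt] := exp2V_lt C e0.
exact: le_trans (xC n) (ltW nlt).
Qed.

(** Neumann series: the partial sums [u n] converge to a two-sided inverse. *)
Lemma unit_1B x : nrm x <= 2^-1 -> 1 - x \is a GRing.unit.
Proof.
move=> x2; pose u n : A := \sum_(i < n) x ^+ i.
have xn n : nrm (x ^+ n) <= nrm (1 : A) / 2 ^+ n.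
  by rewrite -exprVn; apply: nrmX_le.
have [|l lP] := @geometric_cvg R A u (nrm (1 : A)).
  by move=> n; rewrite /u big_ord_recr /= addrC addrK.
have ul n : u n * (1 - x) = 1 - x ^+ n.
  have cu : GRing.comm (1 - x) (u n).
    apply: commr_sum => i _; apply: commrX; apply: commr_sym.
    by apply: commrB; [apply: commr1 | apply: commr_refl].
  by rewrite -cu -opprB mulNr -subrX1 opprB.
have ur n : (1 - x) * u n = 1 - x ^+ n.
  by rewrite -opprB mulNr -subrX1 opprB.
have K0 n : 0 <= (2 ^+ n : R)^-1 by rewrite invr_ge0 exprn_ge0.
(* The defect splits into [l - u n] times [1 - x] and the remainder [x ^+ n]; [K / 2 ^+ n] bounds
   the sum of both. *)
pose K : R := 2 * nrm (1 : A) * nrm (1 - x) + nrm (1 : A).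
apply/unitrP; exists l; split; apply/eqP; rewrite -subr_eq0; apply/eqP;
  apply: (@nrm_small_eq0 _ K) => n.
- have -> : l * (1 - x) - 1 = (l - u n) * (1 - x) - x ^+ n.
    by rewrite mulrBl ul opprB [_ ^+ _ - 1]addrC addrA addrK.
  apply: (le_trans (nrmB _ _)).
  have := nrmM (l - u n) (1 - x); have := lP n; have := xn n; have := K0 n.
  have := nrm_ge0 (1 - x); rewrite /K; nra.
- have -> : (1 - x) * l - 1 = (1 - x) * (l - u n) - x ^+ n.
    by rewrite mulrBr ur opprB [_ ^+ _ - 1]addrC addrA addrK.
  apply: (le_trans (nrmB _ _)).
  have := nrmM (1 - x) (l - u n); have := lP n; have := xn n; have := K0 n.
  have := nrm_ge0 (1 - x); rewrite /K; nra.
Qed.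

Lemma resolventB w (lam mu : R[i]) :
  1 - lam *: w \is a GRing.unit -> 1 - mu *: w \is a GRing.unit ->
  (1 - lam *: w)^-1 - (1 - mu *: w)^-1 =
  (lam - mu) *: ((1 - lam *: w)^-1 * w * (1 - mu *: w)^-1).
Proof.
move=> ul um; rewrite invrB_unit //.
have -> : 1 - mu *: w - (1 - lam *: w) = (lam - mu) *: w.
  by rewrite opprB addrC addrA subrK scalerBl.
by rewrite -scalerAr -scalerAl.
Qed.

(** The resolvent identity bounds [nrm f] by [nrm g + 2^-1 * nrm f], and the last term is absorbed
    on the left. *)
Lemma nrm_resolvent_near w (lam mu : R[i]) :
  1 - lam *: w \is a GRing.unit -> 1 - mu *: w \is a GRing.unit ->
  normc (lam - mu) * (nrm w * nrm (1 - mu *: w)^-1) <= 2^-1 ->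
  nrm (1 - lam *: w)^-1 <= 2 * nrm (1 - mu *: w)^-1.
Proof.
move=> ul um small; set f := (1 - lam *: w)^-1; set g := (1 - mu *: w)^-1.
have fE : f = g + (lam - mu) *: (f * w * g) by rewrite -resolventB // addrC subrK.
have : nrm f <= nrm g + 2^-1 * nrm f.
  rewrite [X in nrm X <= _]fE; apply: (le_trans (nrmD _ _)); rewrite lerD2l nrmZ.
  have h1 : nrm (f * w * g) <= nrm f * (nrm w * nrm g).
    rewrite -mulrA; apply: (le_trans (nrmM _ _)).
    by rewrite ler_wpM2l ?nrm_ge0 // nrmM.
  apply: (le_trans (ler_wpM2l (normc_ge0 _) h1)).
  by rewrite mulrCA [leRHS]mulrC ler_wpM2l ?nrm_ge0.
lra.
Qed.

(** The resolvent is locally bounded, and the disc lies in a compact square. *)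
Lemma nrm_resolvent_bounded w (rho : R) :
  (forall lam : R[i], 1 - lam *: w \is a GRing.unit) ->
  exists M, forall lam : R[i], normc lam <= rho -> nrm (1 - lam *: w)^-1 <= M.
Proof.
move=> uw; pose I := `[- rho, rho]%classic.
pose P (M : R) (z : R * R) := nrm (1 - (z.1 +i* z.2) *: w)^-1 <= M.
have cI : compact (I `*` I) by apply: compact_setX; apply: segment_compact.
move/compact_near_coveringP : cI => /(_ R (pinfty_nbhs R) P _).
case.
  move=> -[x0 y0] _; set g := (1 - (x0 +i* y0) *: w)^-1.
  (* Coordinates within [d] put the parameters within [2 * d], and [2 * d * (nrm w * nrm g)] is then
     at most [2^-1]. *)
  pose d : R := (4 * (nrm w * nrm g + 1))^-1.
  have wg0 : 0 <= nrm w * nrm g by rewrite mulr_ge0 ?nrm_ge0.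
  have d0 : 0 < d by rewrite invr_gt0 mulr_gt0 // ltr_wpDl.
  exists (ball (x0, y0) d, [set M | 2 * nrm g < M]).
    split; first exact: nbhsx_ballx.
    by exists (2 * nrm g); split; rewrite ?num_real.
  move=> -[[x y] M] /= [[/= bx by_] gM].
  rewrite /P /=; apply: le_trans (ltW gM).
  apply: nrm_resolvent_near => //.
  have := normc_ReIm_le ((x +i* y) - (x0 +i* y0)) => /=.
  move: bx by_; rewrite -!ball_normE /= (distrC x0) (distrC y0) => bx by_ h.
  have {}h : normc ((x +i* y) - (x0 +i* y0)) <= 2 * d.
    by apply: (le_trans h); lra.
  apply: (le_trans (ler_wpM2r wg0 h)).
  have : d * (4 * (nrm w * nrm g + 1)) = 1.
    by rewrite /d mulVf // gt_eqF // mulr_gt0 // ltr_wpDl.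
  rewrite -/g; nra.
move=> M0 [_ H]; exists (M0 + 1) => -[x y] xy.
have := H (M0 + 1) (ltr_pwDr ltr01 (lexx _)) (x, y); apply.
by split; rewrite /I /= in_itv /= -ler_norml;
  [have := Re_le_normc (x +i* y) | have := Im_le_normc (x +i* y)];
  move=> /= /le_trans; apply.
Qed.

(** Partial fractions for [1 - y ^+ 2 = (1 + y) * (1 - y)]. With [y = (lam *: w) ^+ (2 ^ k)] this
    passes from [k] to [k.+1]. *)
Lemma invr_sqr_avg y : 1 - y \is a GRing.unit -> 1 + y \is a GRing.unit ->
  1 - y ^+ 2 \is a GRing.unit /\
  (1 - y ^+ 2)^-1 = 2^-1 *: ((1 - y)^-1 + (1 + y)^-1).
Proof.
move=> um up.
have E : 1 - y ^+ 2 = (1 + y) * (1 - y).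
  by rewrite mulrBr mulr1 mulrDl mul1r -expr2 opprD addrA addrK.
split; first by rewrite E unitrMl.
have -> : (1 - y)^-1 + (1 + y)^-1 = 2%:R *: ((1 - y)^-1 * (1 + y)^-1).
  have : (1 - y)^-1 * ((1 + y) + (1 - y)) * (1 + y)^-1 = (1 - y)^-1 + (1 + y)^-1.
    by rewrite mulrDr mulrDl mulrK // mulVr // mul1r.
  have -> : (1 + y) + (1 - y) = 2%:R by rewrite addrACA subrr addr0.
  by move=> <-; rewrite mulr_natr mulrnAl scaler_nat.
by rewrite scalerA mulVf ?pnatr_eq0 // scale1r E invrM.
Qed.

(** In closed form, the average of the resolvents at [zeta * lam] over the [2 ^ k]-th roots of unity
    [zeta]. *)
Definition geom_inv w k (lam : R[i]) : A := (1 - (lam *: w) ^+ (2 ^ k))^-1.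

(** A root [om] of [-1] turns [1 + (lam *: w) ^+ (2 ^ k)] into the same expression with a minus sign
    at [om * lam], so both factors of the difference of squares are units. *)
Lemma geom_inv_spec w k :
  (forall lam : R[i], 1 - lam *: w \is a GRing.unit) ->
  forall lam : R[i], 1 - (lam *: w) ^+ (2 ^ k) \is a GRing.unit.
Proof.
move=> uw; elim: k => [|k IH] lam; first by rewrite expn0 expr1.
have [om [om1 _]] := @unit_root_of_N1 R (2 ^ k) (expn_gt0 2 k).
have := IH (om * lam); rewrite -scalerA exprZn om1 scaleN1r opprK => up.
by rewrite expnSr exprM; have [] := invr_sqr_avg (IH lam) up.
Qed.

(* Averaging over roots of [-1] gives the functions [geom_inv w k] a common
   modulus of continuity, independent of [k]. *)
Lemma geom_inv_equicont w (rho d e : R) :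
  (forall lam : R[i], 1 - lam *: w \is a GRing.unit) ->
  (forall lam mu : R[i], normc lam <= rho -> normc mu <= rho ->
     normc (lam - mu) <= d ->
     nrm ((1 - lam *: w)^-1 - (1 - mu *: w)^-1) <= e) ->
  forall k (lam mu : R[i]), normc lam <= rho -> normc mu <= rho ->
    normc (lam - mu) <= d -> nrm (geom_inv w k lam - geom_inv w k mu) <= e.
Proof.
move=> uw H0; elim=> [|k IH] lam mu ll lm lmd.
  by rewrite /geom_inv expn0 !expr1; apply: H0.
have [om [om1 nom]] := @unit_root_of_N1 R (2 ^ k) (expn_gt0 2 k).
have avg z : geom_inv w k.+1 z = 2^-1 *: (geom_inv w k z + geom_inv w k (om * z)).
  have := geom_inv_spec k uw (om * z); rewrite /geom_inv.
  rewrite -scalerA [(om *: _) ^+ _]exprZn om1 scaleN1r opprK => up.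
  rewrite expnSr exprM.
  by have [_ ->] := invr_sqr_avg (geom_inv_spec k uw z) up.
rewrite !avg -scalerBr nrmZ opprD addrACA.
have := IH _ _ ll lm lmd.
have := IH (om * lam) (om * mu); rewrite -mulrBr !normcM nom !mul1r.
move=> /(_ ll lm lmd) h1 h2.
have := nrmD (geom_inv w k lam - geom_inv w k mu)
          (geom_inv w k (om * lam) - geom_inv w k (om * mu)).
rewrite normc_half; lra.
Qed.

(** A small [y] puts [f] near [1], hence also [f']; then [f' - 1 = y' + (f' - 1) * y'] bounds
    [y']. *)
Lemma small_step y y' (f f' : A) :
  f * (1 - y) = 1 -> f' * (1 - y') = 1 ->
  nrm y <= 8^-1 -> nrm (f' - f) <= 8^-1 -> nrm y' <= 2^-1.
Proof.
move=> fy fy' ny nff.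
have E (h z : A) : h * (1 - z) = 1 -> h - 1 = z + (h - 1) * z.
  by rewrite mulrBr mulr1 mulrBl mul1r addrCA subrr addr0 => <-; rewrite subKr.
have h1 : nrm (f - 1) <= nrm y + nrm (f - 1) * nrm y.
  by rewrite [X in nrm X <= _](E _ _ fy); apply: (le_trans (nrmD _ _));
     rewrite lerD2l nrmM.
have h2 : nrm (f' - 1) <= nrm (f' - f) + nrm (f - 1).
  by rewrite -(subrKA f) nrmD.
have h3 : nrm y' <= nrm (f' - 1) + nrm (f' - 1) * nrm y'.
  have E' : y' = (f' - 1) - (f' - 1) * y' by rewrite [X in X - _](E _ _ fy') addrK.
  rewrite [X in nrm X <= _]E'; apply: (le_trans (nrmB _ _)).
  by rewrite lerD2l nrmM.
have f0 := nrm_ge0 (f - 1); have y0 := nrm_ge0 y'.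
(* By [h1], [nrm (f - 1)] is at most [1/7], and [1/8 + 1/7 < 1/3]. *)
have g1 : nrm (f' - 1) <= 3^-1 by nra.
nra.
Qed.

(* The spectral radius formula at [0], with an elementary proof in the style of
   Rickart: if [(s w)^(2^k)] is small then [geom_inv w k] is close to [1] at [s],
   hence also at nearby points. *)
Lemma spectral_radius0 w :
  (forall lam : R[i], 1 - lam *: w \is a GRing.unit) ->
  forall s : R, 0 <= s -> exists k, nrm ((s%:C *: w) ^+ (2 ^ k)) <= 8^-1.
Proof.
move=> uw s s0; have [M MP] := nrm_resolvent_bounded s uw.
have M0 : 0 <= M by apply: le_trans (MP 0 _); rewrite ?nrm_ge0 ?normc0.
(* [M * nrm w * M] is a Lipschitz constant of the resolvent on the disc of radius [s]. *)
pose d := (8 * (M * nrm w * M + 1))^-1.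
have K0 : 0 <= M * nrm w * M by rewrite !mulr_ge0 ?nrm_ge0.
have d0 : 0 < d by rewrite invr_gt0 mulr_gt0 // ltr_wpDl.
have dK : d * (M * nrm w * M) <= 8^-1.
  have : d * (8 * (M * nrm w * M + 1)) = 1.
    by rewrite /d mulVf // gt_eqF // mulr_gt0 // ltr_wpDl.
  nra.
have lip (lam mu : R[i]) : normc lam <= s -> normc mu <= s ->
    normc (lam - mu) <= d -> nrm ((1 - lam *: w)^-1 - (1 - mu *: w)^-1) <= 8^-1.
  move=> ll lm lmd; rewrite resolventB // nrmZ; apply: le_trans dK.
  rewrite ler_pM ?normc_ge0 ?nrm_ge0 //.
  apply: (le_trans (nrmM _ _)); rewrite ler_pM ?nrm_ge0 ?MP //.
  by apply: (le_trans (nrmM _ _)); rewrite ler_wpM2r ?nrm_ge0 ?MP.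
have equi := geom_inv_equicont uw lip.
have step (t t' : R) : 0 <= t <= s -> 0 <= t' <= s -> `|t' - t| <= d ->
    (exists k, nrm ((t%:C *: w) ^+ (2 ^ k)) <= 8^-1) ->
    exists k, nrm ((t'%:C *: w) ^+ (2 ^ k)) <= 8^-1.
  (* Moving the parameter weakens the bound to [1/2]; two more squarings bring it to [1/16]. *)
  move=> /andP[t0 ts] /andP[t0' ts'] tt [k kP]; exists k.+2.
  have kP' : nrm ((t'%:C *: w) ^+ (2 ^ k)) <= 2^-1.
    apply: (small_step _ _ kP).
    - exact: (mulVr (geom_inv_spec k uw t%:C)).
    - exact: (mulVr (geom_inv_spec k uw t'%:C)).
    apply: equi; first [by rewrite normc_real ger0_norm | by rewrite -rmorphB normc_real].
  rewrite (expnSr 2 k.+1) (expnSr 2 k) -mulnA exprM; apply: (le_trans (nrmX _ _)) => //.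
  apply: (@le_trans _ _ (2^-1 ^+ (2 * 2))).
    by rewrite lerXn2r // ?nnegrE ?nrm_ge0 ?invr_ge0.
  by rewrite (_ : (2 * 2)%N = 4%N) // !exprS expr0; lra.
have [n sn] : exists n, s <= n%:R * d.
  have [n _ /(_ n (leqnn n)) /= h] := nbhs_infty_ger (s / d).
  by exists n; rewrite -ler_pdivrMr.
(* The parameter walks from [0] to [s] in steps of length at most [d]. *)
suff H m : exists k, nrm (((Num.min s (m%:R * d))%:C *: w) ^+ (2 ^ k)) <= 8^-1.
  by have := H n; rewrite (min_idPl sn).
elim: m => [|m IH].
  exists 0%N; rewrite mul0r (min_idPr s0) scale0r expn0 expr1 nrm0.
  by rewrite invr_ge0.
apply: step IH; rewrite ?le_min ?ge_min ?lexx ?s0 ?mulr_ge0 ?(ltW d0) //.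
rewrite -natr1 mulrDl mul1r ler_norml !minEle.
by case: ifP; case: ifP; lra.
Qed.

End Spectral.

(** * Quasinilpotent elements and square roots *)

Section Quasinilpotent.
Variables (R : realType) (A : banachAlgType R[i]).
Implicit Types w x y z c : A.

Lemma unit_1B_expr x n : (0 < n)%N ->
  1 - x ^+ n \is a GRing.unit -> 1 - x \is a GRing.unit.
Proof.
case: n => // n _; pose S : A := \sum_(i < n.+1) x ^+ i.
have cS : GRing.comm (1 - x) S.
  apply: commr_sum => i _; apply: commrX; apply: commr_sym.
  by apply: commrB; [apply: commr1 | apply: commr_refl].
have <- : (1 - x) * S = 1 - x ^+ n.+1 by rewrite -opprB mulNr -subrX1 opprB.
by rewrite unitrM_comm // => /andP[].
Qed.

(** Scalars lie in the commutant, which gives one direction. Conversely the spectral radius formula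
    controls products with every commuting element. *)
Lemma qnilP w :
  qnil w <-> forall lam : R[i], 1 - lam *: w \is a GRing.unit.
Proof.
split=> [qw lam|uw x cx].
  have -> : 1 - lam *: w = 1 + w * (- lam *: 1) by rewrite -scalerAr mulr1 scaleNr.
  by apply: qw; rewrite /commutant /= /GRing.comm -scalerAl -scalerAr mul1r mulr1.
(* With [N = 2 ^ k], the choice [s = nrm x] gives [nrm x ^+ N * nrm (w ^+ N) <= 8^-1], so the [N]-th
   power of [- (w * x)] is small. *)
have [k] := spectral_radius0 uw (nrm_ge0 x).
rewrite exprZn -rmorphXn nrmZ normc_real ger0_norm ?exprn_ge0 ?nrm_ge0 // => h.
rewrite -[w * x]opprK; apply: (@unit_1B_expr _ (2 ^ k)); first by rewrite expn_gt0.
apply: unit_1B; rewrite -mulrN exprMn_comm; last exact/commrN/commr_sym.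
apply: (le_trans (nrmM _ _)).
have := nrmX (- x) (expn_gt0 2 k); rewrite nrmN => /= hx.
have := ler_wpM2l (nrm_ge0 (w ^+ (2 ^ k))) hx.
by rewrite [_ * nrm x ^+ _]mulrC; lra.
Qed.

Lemma qnilM w c : qnil w -> GRing.comm w c -> qnil (w * c).
Proof.
move=> qw cwc; apply/qnilP => lam.
have -> : 1 - lam *: (w * c) = 1 + w * (- lam *: c) by rewrite -scalerAr scaleNr.
by apply: qw; rewrite /commutant /= /GRing.comm -scalerAl -scalerAr cwc.
Qed.

Lemma qnil_sqr x : qnil (x ^+ 2) -> qnil x.
Proof.
move=> /qnilP qx; apply/qnilP => lam; apply: (@unit_1B_expr _ 2) => //.
by rewrite exprZn.
Qed.

(** For [z = 2 w] some power [z ^+ N] has norm at most [8^-1]; peeling off blocks of [N] factors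
    reduces every power of [z] to the first [N]. *)
Lemma qnil_expr_bound w : qnil w ->
  exists C, forall n, nrm (w ^+ n) <= C / 2 ^+ n.
Proof.
move=> /qnilP uw; have [k] := spectral_radius0 uw (ler0n R 2).
set z := _ *: w; set N := (2 ^ k)%N => zN.
exists (\sum_(m < N) nrm (z ^+ m)).
suff H n : nrm (z ^+ n) <= \sum_(m < N) nrm (z ^+ m).
  move=> n; have := H n; rewrite exprZn -rmorphXn nrmZ normc_real ger0_norm //.
  by rewrite ler_pdivlMr ?exprn_gt0 // mulrC.
elim/ltn_ind: n => n IH; have [nN|Nn] := ltnP n N.
  by rewrite (bigD1 (Ordinal nN)) //= lerDl sumr_ge0 // => i _; rewrite nrm_ge0.
have N0 : (0 < N)%N by rewrite expn_gt0.
have := IH (n - N)%N; rewrite ltn_subrL N0 (leq_trans N0 Nn) => /(_ isT).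
apply: le_trans; rewrite -{1}(subnKC Nn) exprD.
apply: (le_trans (nrmM _ _)).
have := nrm_ge0 (z ^+ (n - N)); nra.
Qed.

(* [gauge w c x] bounds by [c] the operator norm of right multiplication by [x]
   with respect to the norm [sup_k 2 ^ k * nrm (y * w ^ k)], for which [w] has
   norm at most [1/2]. *)
Definition gauge w (c : R) x := forall y (M : R),
  (forall k, nrm (y * w ^+ k) <= M / 2 ^+ k) ->
  forall k, nrm (y * x * w ^+ k) <= M * c / 2 ^+ k.

Lemma gauge_le w (c c' : R) x : c <= c' -> gauge w c x -> gauge w c' x.
Proof.
move=> cc' gx y M yM k; apply: (le_trans (gx _ _ yM k)).
rewrite ler_wpM2r ?invr_ge0 ?exprn_ge0 // ler_wpM2l //.
by have := yM 0%N; rewrite !expr0 divr1 mulr1; apply: le_trans (nrm_ge0 _).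
Qed.

Lemma gauge_self w : gauge w 2^-1 w.
Proof.
move=> y M yM k; rewrite -mulrA -exprS (le_trans (yM _)) //.
by rewrite exprS invfM mulrA lexx.
Qed.

Lemma gauge1 w : gauge w 1 1.
Proof. by move=> y M yM k; rewrite !mulr1. Qed.

Lemma gaugeD w (c d : R) x z : gauge w c x -> gauge w d z -> gauge w (c + d) (x + z).
Proof.
move=> gx gz y M yM k; rewrite mulrDr mulrDl (le_trans (nrmD _ _)) //.
by rewrite mulrDr mulrDl lerD ?gx ?gz.
Qed.

Lemma gaugeZ w (c : R) (lam : R[i]) x :
  gauge w c x -> gauge w (normc lam * c) (lam *: x).
Proof.
move=> gx y M yM k; rewrite -scalerAr -scalerAl nrmZ [M * _]mulrCA -[leRHS]mulrA.
by rewrite ler_wpM2l ?normc_ge0 ?gx.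
Qed.

Lemma gaugeN w (c : R) x : gauge w c x -> gauge w c (- x).
Proof. by move=> gx y M yM k; rewrite mulrN mulNr nrmN gx. Qed.

Lemma gaugeM w (c d : R) x z : gauge w c x -> gauge w d z -> gauge w (c * d) (x * z).
Proof.
move=> gx gz y M yM k; rewrite mulrA [M * _]mulrA.
by apply: gz => j; apply: gx.
Qed.

(** The equation amounts to [w * v] solving [2 t + t ^+ 2 = w], which holds if [v] is a fixed point
    of [F]. In the gauge, [w] has norm at most [1/2], and the iteration contracts. *)
Lemma qnil_sqrt w : qnil w ->
  exists v, (forall z, GRing.comm z w -> GRing.comm z v) /\
    (1 + w * v) ^+ 2 = 1 + w.
Proof.
move=> /qnil_expr_bound[C wC].
pose F v : A := 2^-1 *: (1 - w * v ^+ 2); pose u n := iter n F 0.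
have uS n : u n.+1 = F (u n) by [].
have ucomm z : GRing.comm z w -> forall n, GRing.comm z (u n).
  move=> zw; elim=> [|n IH]; first exact: commr0.
  rewrite uS /F -[_ *: (_ - _)]mulr_algl.
  apply: commrM; first by rewrite /GRing.comm mulr_algl mulr_algr.
  by apply: commrB; [apply: commr1 | apply: commrM => //; apply: commrX].
(* [F] preserves the gauge unit ball: its values have gauge at most [2^-1 * (1 + 2^-1)]. *)
have gu n : gauge w 1 (u n).
  elim: n => [|n IH].
    by apply: (@gauge_le _ 0) => // y M yM k; rewrite mulr0 mul0r nrm0 mulr0 mul0r.
  rewrite uS /F expr2.
  have := gaugeZ 2^-1 (gaugeD (@gauge1 w)
    (gaugeN (gaugeM (@gauge_self w) (gaugeM IH IH)))).
  by apply: gauge_le; rewrite normc_half; lra.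
(* Differences halve: the factors [2^-1], [w] and [u n.+1 + u n] contribute [1/2], [1/2] and [2]. *)
have gdu n : gauge w (2 ^+ n)^-1 (u n.+1 - u n).
  elim: n => [|n IH].
    rewrite uS /F subr0 expr0n mulr0 subr0.
    by apply: gauge_le (gaugeZ 2^-1 (@gauge1 w)); rewrite normc_half expr0; lra.
  have cu : GRing.comm (u n) (u n.+1) by apply/ucomm/commr_sym/ucomm.
  have -> : u n.+2 - u n.+1 = 2^-1 *: - (w * ((u n.+1 - u n) * (u n.+1 + u n))).
    rewrite (uS n.+1) [X in _ - X]uS /F -scalerBr; congr (_ *: _).
    rewrite opprB addrC addrA subrK -mulrBr -[RHS]mulrN; congr (_ * _).
    by rewrite [in RHS]mulrDr !mulrBl cu addrA subrK opprB !expr2.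
  have := gaugeZ 2^-1 (gaugeN (gaugeM (@gauge_self w)
    (gaugeM IH (gaugeD (gu n.+1) (gu n))))).
  apply: gauge_le; by rewrite normc_half exprS invfM; lra.
(* Back to the norm by evaluating the gauge at [y = 1], [k = 0]. *)
have gauge_nrm (c : R) x : gauge w c x -> nrm x <= C * c.
  move=> /(_ 1 C); have w1 k : nrm (1 * w ^+ k) <= C / 2 ^+ k by rewrite mul1r.
  by move=> /(_ w1 0%N); rewrite !expr0 mulr1 mul1r divr1.
have [|v vP] := @geometric_cvg R A u C.
  by move=> n; apply: gauge_nrm (gdu n).
exists v.
have vcomm z : GRing.comm z w -> GRing.comm z v.
  move=> zw; apply/eqP; rewrite -subr_eq0; apply/eqP.
  apply: (@nrm_small_eq0 _ _ _ (2 * (nrm z * (2 * C)))) => n.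
  have -> : z * v - v * z = z * (v - u n) - (v - u n) * z.
    by rewrite mulrBr mulrBl (ucomm z zw n) opprB addrA subrK.
  apply: (le_trans (nrmB _ _)).
  have := nrmM z (v - u n); have := nrmM (v - u n) z.
  have := vP n; have := nrm_ge0 z; nra.
split=> //.
(* [v - F v] is written in terms of the errors [v - u n.+1] and [v - u n], both of order
   [2 ^- n]. *)
have vE : v = F v.
  apply/eqP; rewrite -subr_eq0; apply/eqP.
  pose K := 2 * C + nrm w * (C + nrm v) * (2 * C).
  apply: (@nrm_small_eq0 _ _ _ K) => n.
  have -> : v - F v = (v - u n.+1) + 2^-1 *: (w * (u n * (v - u n) + (v - u n) * v)).
    have -> : u n * (v - u n) + (v - u n) * v = v ^+ 2 - u n ^+ 2.
      by rewrite mulrBr mulrBl addrC addrA subrK !expr2.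
    rewrite uS /F -[RHS]addrA; congr (_ + _).
    rewrite -!scalerN -scalerDr; congr (_ *: _).
    by rewrite mulrBr !opprB [RHS]addrC addrA subrK.
  apply: (le_trans (nrmD _ _)); rewrite nrmZ normc_half.
  have un := gauge_nrm _ _ (gu n).
  have h1 := nrmM w (u n * (v - u n) + (v - u n) * v).
  have h2 := nrmD (u n * (v - u n)) ((v - u n) * v).
  have h3 := nrmM (u n) (v - u n).
  have h4 := nrmM (v - u n) v.
  have h5 := vP n; have h6 := vP n.+1.
  have C0 : 0 <= C by have := wC 0%N; rewrite expr0 divr1; apply: le_trans (nrm_ge0 _).
  set q := 2 * C / 2 ^+ n in h5 *.
  have h7 : 2 * C / 2 ^+ n.+1 <= q.
    rewrite exprS invfM mulrCA ler_piMl ?invf_le1 ?ler1n //.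
    by rewrite divr_ge0 ?mulr_ge0 ?exprn_ge0.
  have -> : K / 2 ^+ n = q + nrm w * (C + nrm v) * q by rewrite /K /q; ring.
  have h8 : nrm (u n * (v - u n) + (v - u n) * v) <= (C + nrm v) * q.
    have := nrm_ge0 v; have := nrm_ge0 (v - u n); nra.
  have := ler_wpM2l (nrm_ge0 w) h8.
  have := nrm_ge0 (w * (u n * (v - u n) + (v - u n) * v)); lra.
pose t := w * v; have wv : GRing.comm w v by apply: vcomm.
have tE : t = 2^-1 *: (w - t ^+ 2).
  rewrite {1}/t vE /F -scalerAr mulrBr mulr1 /t exprMn_comm //.
  by rewrite mulrA -expr2.
have t2 : t *+ 2 = w - t ^+ 2.
  by rewrite [in LHS]tE -scaler_nat scalerA mulfV ?pnatr_eq0 // scale1r.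
by rewrite -/t [1 + t]addrC sqrrD1 t2 [_ ^+ 2 + _]addrC subrK addrC.
Qed.
End Quasinilpotent.

(** * The two implications *)

Lemma sqrrD_comm (S : pzSemiRingType) (x y : S) : GRing.comm x y ->
  (x + y) ^+ 2 = x ^+ 2 + x * y *+ 2 + y ^+ 2.
Proof.
by move=> xy; rewrite exprDn_comm // !big_ord_recr big_ord0 /= add0r mulr1 mul1r.
Qed.

Lemma gHirano_tripotent (R : realType) (A : banachAlgType R[i]) (a : A) :
  has_gHirano_inverse a ->
  exists e : A, [/\ commutant a e, e ^+ 3 = e & qnil (a - e)].
Proof.
move=> [b [cba bE]]; set p := a * b; set w := _ - p => qw.
have cab : GRing.comm a b by apply: commr_sym.
have pp : p * p = p by rewrite /p -mulrA [b * (a * b)]mulrA -bE.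
have cap : GRing.comm a p by apply: commrM => //; apply: commr_refl.
have comm_w z : GRing.comm z a -> GRing.comm z p -> GRing.comm z w.
  by move=> za zp; apply: commrB => //; apply: commrX.
have [v [vcomm vE]] := qnil_sqrt qw.
have caw : GRing.comm a w by apply: comm_w => //; apply: commr_refl.
have cpw : GRing.comm p w by apply: comm_w; [apply: commr_sym | apply: commr_refl].
have cav := vcomm a caw; have cpv := vcomm p cpw; have cwv := vcomm w (commr_refl w).
set t := 1 + w * v in vE.
have cat : GRing.comm a t by apply: commrD; [apply: commr1 | apply: commrM].
have cpt : GRing.comm p t by apply: commrD; [apply: commr1 | apply: commrM].
have ut : t \is a GRing.unit.
  have := qnilM qw cwv => /qnilP /(_ (-1)).
  by rewrite scaleN1r opprK.
have a2p : a ^+ 2 * p = p * t ^+ 2.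
  have -> : a ^+ 2 = w + p by rewrite subrK.
  by rewrite mulrDl pp vE mulrDr mulr1 cpw addrC.
(* On the corner cut out by the idempotent [p], [a ^+ 2] and [t ^+ 2] agree, so [a / t] is an
   involution there. *)
pose e := a * p / t.
have ae : a * e = p * t.
  by rewrite /e mulrA [a * (a * p)]mulrA -expr2 a2p expr2 mulrA mulrK.
have ce z : GRing.comm z a -> GRing.comm z p -> GRing.comm z t -> GRing.comm z e.
  by move=> za zp zt; apply: commrM; [apply: commrM | apply: commrV].
have cae : GRing.comm a e by apply: ce => //; apply: commr_refl.
have ee : e ^+ 2 = p.
  have cte : GRing.comm t e.
    by apply: ce; [apply: commr_sym | apply: commr_sym | apply: commr_refl].
  have cpe : GRing.comm p e by apply: ce.
  have -> : e ^+ 2 = e * a * p / t by rewrite expr2 {2}/e !mulrA.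
  by rewrite -cae ae -[p * t * p]mulrA -cpt [p * (p * t)]mulrA pp mulrK.
exists e; split.
- exact: commr_sym.
- by rewrite exprSr ee /e mulrA [p * (a * p)]mulrA -cap -[a * p * p]mulrA pp.
apply: qnil_sqr.
(* Expanding, [a ^+ 2 - 2 a e + e ^+ 2 = (w + p) - 2 p (1 + w v) + p]. *)
have -> : (a - e) ^+ 2 = w * (1 - (p * v) *+ 2).
  rewrite sqrrD_comm; last exact: commrN.
  rewrite mulrN sqrrN mulNrn ae ee -[a ^+ 2](subrK p) -/w /t mulrDr mulr1.
  rewrite mulrA cpw -mulrA mulrnDl opprD addrAC -(addrA w) -mulr2n addrA addrK.
  by rewrite mulrBr mulr1 mulrnAr.
apply: qnilM => //; apply: commrB; first exact: commr1.
by apply: commrMn; apply: commrM => //; apply: commr_sym.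
Qed.

Lemma tripotent_gHirano (R : realType) (A : banachAlgType R[i]) (a e : A) :
  commutant a e -> e ^+ 3 = e -> qnil (a - e) -> has_gHirano_inverse a.
Proof.
move=> cea e3; set q := a - e => qq.
have ceq : GRing.comm e q by apply: commrB => //; apply: commr_refl.
have caq : GRing.comm a q.
  by apply: commrB; [apply: commr_refl | apply: commr_sym].
have aE : a = e + q by rewrite addrC subrK.
clearbody q; pose t := 1 + q * e.
have ut : t \is a GRing.unit by apply: qq.
have cet : GRing.comm e t.
  by apply: commrD; [apply: commr1 | apply: commrM => //; apply: commr_refl].
(* Since [e ^+ 3 = e], [e ^+ 2 * t = e ^+ 2 + q * e = a * e]. *)
have abE : a * (e / t) = e ^+ 2.
  rewrite mulrA.
  have -> : a * e = e ^+ 2 * t.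
    by rewrite aE mulrDl mulrDr mulr1 -expr2 -ceq mulrA -exprSr e3.
  by rewrite mulrK.
exists (e / t); split.
- rewrite /commutant /=; apply: commr_sym; apply: commrM; first exact: commr_sym.
  apply: commrV; apply: commrD; first exact: commr1.
  by apply: commrM => //; apply: commr_sym.
- have cetV : GRing.comm (e ^+ 2) t^-1.
    by apply/commrV/commr_sym/commrX/commr_sym.
  by rewrite -[RHS]mulrA abE -[RHS]mulrA -cetV mulrA -exprS e3.
- have -> : a ^+ 2 - a * (e / t) = q * (e *+ 2 + q).
    rewrite abE aE sqrrD_comm // addrAC [e ^+ 2 + _]addrC addrK.
    by rewrite mulrDr mulrnAr ceq expr2.
  apply: qnilM => //; apply: commrD; last exact: commr_refl.
  by apply: commrMn; apply: commr_sym.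
Qed.

Unset Implicit Arguments.

Theorem theorem2p7 (R : realType) (A : banachAlgType R[i]) (a : A) :
  has_gHirano_inverse a <->
  exists e : A, [/\ commutant a e, e ^+ 3 = e & qnil (a - e)].
Proof.
split; first exact: gHirano_tripotent.
by move=> [e [cea e3 qe]]; apply: tripotent_gHirano cea e3 qe.
Qed.
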